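(* Let $N\ge 2$ be an integer and $R>0$. Let $D$ be the chord length of the $N$-sphere of radius $R$, i.e. $D=\|p_1-p_2\|$ where $p_1,p_2$ are independent and uniformly distributed on the $N$-sphere of radius $R$. Then the cumulative distribution function $F_N(d)=P(D\le d)$ is given, for $0\le d\le 2R$, by $$F_N(d)=\frac12\, I_{\frac{d^2}{R^2}-\frac{d^4}{4R^4}}\left(\frac{N-1}{2},\frac12\right)\quad\text{if } d<\sqrt2 R,$$ $$F_N(d)=1-\frac12\, I_{\frac{d^2}{R^2}-\frac{d^4}{4R^4}}\left(\frac{N-1}{2},\frac12\right)\quad\text{if } d\ge\sqrt2 R.$$
   Context: The $N$-sphere of radius $R$ means the hypersphere $\{x\in\mathbb{R}^N: x_1^2+\dots+x_N^2=R^2\}$ in $N$-dimensional Euclidean space; ''uniformly distributed'' refers to the normalized surface measure on it. $\|\cdot\|$ is the Euclidean norm. $I_x(a,b)$ is the regularised incomplete beta function $I_x(a,b)=\frac{\int_0^x t^{a-1}(1-t)^{b-1}dt}{\int_0^1 t^{a-1}(1-t)^{b-1}dt}$ for $0\le x\le 1$, $a,b>0$. *)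

(* Defs.v *)
From HB Require Import structures.
From mathcomp Require Import all_boot all_order all_algebra.
From mathcomp Require Import all_classical all_reals all_analysis.

Set Implicit Arguments.
Unset Strict Implicit.
Unset Printing Implicit Defensive.

Import Order.TTheory GRing.Theory Num.Theory.
Import numFieldNormedType.Exports.

Local Open Scope classical_set_scope.
Local Open Scope ring_scope.

(* R^N is N.-tuple R, with the product sigma-algebra provided by the library;
   it is the Borel sigma-algebra of R^N. *)

Definition euclid_dist (R : realType) (N : nat) (x y : N.-tuple R) : R :=
  Num.sqrt (\sum_(i < N) (tnth x i - tnth y i) ^+ 2).

Definition hypersphere (R : realType) (N : nat) (r : R) : set (N.-tuple R) :=
  [set x | \sum_(i < N) tnth x i ^+ 2 = r ^+ 2].

(* As a real [sup], this is meaningful for bounded sets only; it is 0 on the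
   empty set. *)
Definition diameter (R : realType) (N : nat) (U : set (N.-tuple R)) : R :=
  sup [set euclid_dist z.1 z.2 | z in U `*` U].

Definition delta_cover (R : realType) (N : nat) (delta : R)
    (A : set (N.-tuple R)) : set (nat -> set (N.-tuple R)) :=
  [set U | A `<=` \bigcup_i U i /\
           forall i x y, U i x -> U i y -> euclid_dist x y <= delta].

(* The s-dimensional Hausdorff (outer) measure for an integer s >= 1, without
   the usual constant factor, which is immaterial after normalization.  (For
   s = 0 empty covering sets would be counted with weight 1.)  On an
   s-dimensional C^1 submanifold of R^N it is, up to that factor, the
   surface measure. *)
Definition hausdorff_content (R : realType) (N s : nat) (delta : R)
    (A : set (N.-tuple R)) : \bar R :=
  ereal_inf [set (\sum_(0 <= i <oo) (diameter (U i) ^+ s)%:E)%E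
            | U in delta_cover delta A].

Definition hausdorff_measure (R : realType) (N s : nat)
    (A : set (N.-tuple R)) : \bar R :=
  ereal_sup [set hausdorff_content s delta A
            | delta in [set delta : R | 0 < delta]].

(* The law of X is the normalized surface measure on the sphere of radius r.
   The conventions 0^-1 = +oo and +oo^-1 = 0 introduce no junk case: at
   A = setT the equation excludes a total mass of 0 or +oo. *)
Definition uniform_on_sphere (R : realType) (d : measure_display)
    (T : measurableType d) (P : probability T R) (N : nat) (r : R)
    (X : {RV P >-> N.-tuple R}) : Prop :=
  forall A : set (N.-tuple R), measurable A ->
    distribution P X A =
      (hausdorff_measure N.-1 (A `&` hypersphere r) /
       hausdorff_measure N.-1 (@hypersphere R N r))%E.

Definition independent_RV (R : realType) (d d1 d2 : measure_display)
    (T : measurableType d) (T1 : measurableType d1) (T2 : measurableType d2)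
    (P : probability T R) (X : {RV P >-> T1}) (Y : {RV P >-> T2}) : Prop :=
  forall (A : set T1) (B : set T2), measurable A -> measurable B ->
    P (X @^-1` A `&` Y @^-1` B) = (P (X @^-1` A) * P (Y @^-1` B))%E.

Definition incomplete_beta (R : realType) (x a b : R) : R :=
  \int[@lebesgue_measure R]_(t in `[0, x]) (t `^ (a - 1) * (1 - t) `^ (b - 1)).

Definition reg_incomplete_beta (R : realType) (x a b : R) : R :=
  incomplete_beta x a b / incomplete_beta 1 a b.

(* Main.v *)
Require Import Defs.
From HB Require Import structures.
From mathcomp Require Import all_boot all_order all_algebra.
From mathcomp Require Import all_classical all_reals all_analysis.
From mathcomp Require Import measurable_realfun ring lra.

Set Implicit Arguments.
Unset Strict Implicit.
Unset Printing Implicit Defensive.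

Import Order.TTheory GRing.Theory Num.Theory.
Import numFieldNormedType.Exports.
Local Open Scope classical_set_scope.
Local Open Scope ring_scope.

(** The only property of the surface measure that is needed is its invariance
    under Householder reflections, which holds because Hausdorff measure is
    invariant under isometries.  A reflection carrying [p1] to the pole
    [r e_i] reduces the law of the distance, by independence and Fubini, to the
    measure of a spherical cap, i.e. to the law of one coordinate [y_i].

    By invariance [E (y_i + t y_j)^(2m) = (1 + t^2)^m E y_i^(2m)] for every [t];
    comparing the coefficients of [t^2] and summing over [j] gives
    [(2k + 1) E Z^k = (2k + N) E Z^(k+1)] for [Z = (y_i / r)^2].  Integration by
    parts gives the same recursion for [1 - t] under the density
    [t^((N-3)/2) (1 - t)^(-1/2)].  A law on [[0, 1]] is determined by its
    moments, so [1 - Z] has the Beta((N - 1)/2, 1/2) law. *)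

Lemma Rintegral_sum {d : measure_display} {T : measurableType d} {R : realType}
    (mu : {measure set T -> \bar R}) (D : set T) (I : Type) (s : seq I)
    (f : I -> T -> R) : measurable D ->
  (forall i, mu.-integrable D (EFin \o f i)) ->
  \int[mu]_(x in D) (\sum_(i <- s) f i x) = \sum_(i <- s) \int[mu]_(x in D) f i x.
Proof.
move=> mD fi; rewrite /Rintegral; under eq_integral do rewrite -sumEFin.
rewrite integral_sum// -sum_fine// => i _.
by apply: (integrable_fin_num mD); exact: fi.
Qed.

(** * Householder reflections and Hausdorff measure *)

Section geometry.
Context {R : realType} {N : nat}.
Implicit Types (x y z v a b : N.-tuple R) (A : set (N.-tuple R)).

Definition dotp x y : R := \sum_(i < N) tnth x i * tnth y i.

(* At [v = 0] the division by zero gives the identity map. *)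
Definition householder v x : N.-tuple R :=
  [tuple tnth x i - 2 * dotp v x / dotp v v * tnth v i | i < N].

Lemma dotpC x y : dotp x y = dotp y x.
Proof. by apply: eq_bigr => i _; rewrite mulrC. Qed.

(** The coordinatewise hypothesis lets one lemma serve reflections, differences of vectors and
    multiples of coordinate vectors alike. *)
Lemma dotp_subZl x y v z (c : R) :
  (forall i, tnth z i = tnth x i - c * tnth v i) ->
  dotp z y = dotp x y - c * dotp v y.
Proof.
move=> zE; rewrite /dotp mulr_sumr -sumrB; apply: eq_bigr => i _.
by rewrite zE; ring.
Qed.

Lemma dotp_eq0 v : dotp v v = 0 -> forall i, tnth v i = 0.
Proof.
move=> /eqP; rewrite psumr_eq0 => [/allP h i|i _]; last by rewrite -expr2 sqr_ge0.
by have := h i (mem_index_enum i); rewrite /= mulf_eq0 orbb => /eqP.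
Qed.

Lemma tnth_householder v x i : tnth (householder v x) i =
  tnth x i - 2 * dotp v x / dotp v v * tnth v i.
Proof. by rewrite tnth_mktuple. Qed.

Lemma dotp_householder_l v x y : dotp (householder v x) y =
  dotp x y - 2 * dotp v x / dotp v v * dotp v y.
Proof. by apply: dotp_subZl => i; rewrite tnth_householder. Qed.

Lemma dotp_householder v x y :
  dotp (householder v x) (householder v y) = dotp x y.
Proof.
rewrite dotp_householder_l !(dotpC _ (householder v y)) !dotp_householder_l.
rewrite (dotpC y x) (dotpC y v).
have [->|vv0] := eqVneq (dotp v v) 0; first by rewrite invr0; ring.
by field.
Qed.

Lemma dotp_householder_sym v x y :
  dotp (householder v x) y = dotp x (householder v y).
Proof.
by rewrite (dotpC x) !dotp_householder_l (dotpC y x); congr (_ - _); ring.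
Qed.

Lemma householderK v : involutive (householder v).
Proof.
move=> x; apply: eq_from_tnth => i; rewrite !tnth_householder.
rewrite (dotpC v (householder v x)) dotp_householder_l (dotpC x v).
have [->|vv0] := eqVneq (dotp v v) 0; first by rewrite invr0; ring.
by field.
Qed.

(** With [v = a - b], equal norms give [v.v = 2 (v.a)], so the reflection subtracts exactly [v] from
    [a]. If [v = 0], then [a = b] and the reflection is the identity. *)
Lemma householder_swap a b : dotp a a = dotp b b ->
  householder [tuple tnth a i - tnth b i | i < N] a = b.
Proof.
move=> ab; set v := [tuple _ | _ < _].
have vE i : tnth v i = tnth a i - 1 * tnth b i by rewrite tnth_mktuple mul1r.
have vy y : dotp v y = dotp a y - dotp b y by rewrite (dotp_subZl y vE) mul1r.
apply: eq_from_tnth => i; rewrite tnth_householder.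
have [vv0|vv0] := eqVneq (dotp v v) 0.
  have := dotp_eq0 vv0 i; rewrite vE mul1r => /eqP; rewrite subr_eq0 => /eqP ->.
  by rewrite vv0 invr0; ring.
have vv : dotp v v = 2 * dotp v a.
  rewrite {1}vy (dotpC a v) (dotpC b v) !vy (dotpC b a) -ab; ring.
by rewrite -vv divff// vE; ring.
Qed.

Lemma sqdistE x y : \sum_(i < N) (tnth x i - tnth y i) ^+ 2 =
  dotp x x - 2 * dotp x y + dotp y y.
Proof.
rewrite /dotp mulr_sumr -sumrB -big_split/=.
by apply: eq_bigr => i _; ring.
Qed.

Lemma euclid_dist_householder v x y :
  euclid_dist (householder v x) (householder v y) = euclid_dist x y.
Proof. by rewrite /euclid_dist !sqdistE !dotp_householder. Qed.

Lemma hypersphereE (r : R) x : hypersphere r x <-> dotp x x = r ^+ 2.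
Proof.
by rewrite /hypersphere/= /dotp; under eq_bigr do rewrite expr2.
Qed.

Lemma preimage_householder_hypersphere v (r : R) :
  householder v @^-1` hypersphere r = hypersphere r.
Proof.
apply/seteqP; split => x /= /hypersphereE h; apply/hypersphereE;
  by move: h; rewrite dotp_householder.
Qed.

Lemma measurable_dotp x : measurable_fun setT (dotp x).
Proof.
apply: measurable_sum => i; apply: measurable_funM => //.
exact: measurable_tnth.
Qed.

Lemma measurable_householder v : measurable_fun setT (householder v).
Proof.
apply/measurable_fun_tnthP => i; rewrite (_ : _ \o _ = fun x : N.-tuple R =>
  tnth x i - 2 * dotp v x / dotp v v * tnth v i); last first.
  by apply/funext => x /=; rewrite tnth_householder.
apply: measurable_funB; first exact: measurable_tnth.
do 3 (apply: measurable_funM => //); exact: measurable_dotp.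
Qed.

HB.instance Definition _ v :=
  isMeasurableFun.Build _ _ _ _ (householder v) (measurable_householder v).

Lemma measurable_hypersphere (r : R) : measurable (@hypersphere R N r).
Proof.
have m : measurable_fun [set: N.-tuple R]
    (fun x => \sum_(i < N) tnth x i ^+ 2).
  by apply: measurable_sum => i; apply: measurable_funX; exact: measurable_tnth.
by have := m measurableT [set r ^+ 2] (measurable_set1 _); rewrite setTI.
Qed.

(** Preimages under [h] turn a cover of a set into a cover of its preimage with the same diameters,
    which gives one inequality between contents. Applying it to the preimage, with [h \o h = id],
    gives the other. *)
Lemma hausdorff_measure_isometric_involution (s : nat)
    (h : N.-tuple R -> N.-tuple R) A : involutive h ->
  (forall x y, euclid_dist (h x) (h y) = euclid_dist x y) ->
  hausdorff_measure s (h @^-1` A) = hausdorff_measure s A.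
Proof.
move=> hK hd.
have diamE U : diameter (h @^-1` U) = diameter U.
  rewrite /diameter; congr (sup _); apply/seteqP; split => _ [[x y] /= [Ux Uy] <-].
    by exists (h x, h y) => //=; rewrite hd.
  by exists (h x, h y); [rewrite /= !hK|rewrite /= hd].
suff le B delta : (hausdorff_content s delta (h @^-1` B) <=
                  hausdorff_content s delta B)%E.
  rewrite /hausdorff_measure; congr (ereal_sup _).
  apply: eq_imagel => delta _; apply/eqP; rewrite eq_le le/=.
  have := le (h @^-1` A) delta; rewrite -comp_preimage.
  by rewrite (_ : h \o h = id)//; apply/funext => x /=; rewrite hK.
apply: ereal_inf_le_tmp => _ [U [BU Ud] <-].
exists (fun i => h @^-1` U i).
  split; first by move=> x /BU [i _ Ui]; exists i.
  by move=> i x y Ux Uy; rewrite -hd; exact: Ud Ux Uy.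
by apply: eq_eseriesr => i _; rewrite diamE.
Qed.

(** * Invariance and support of the uniform law on the sphere *)

Section law.
Context {d : measure_display} {T : measurableType d} (P : probability T R).
Variables (r : R) (X : {RV P >-> N.-tuple R}).
Hypothesis uX : uniform_on_sphere r X.

Lemma uniform_householder v A : measurable A ->
  distribution P X (householder v @^-1` A) = distribution P X A.
Proof.
move=> mA; have mA' : measurable (householder v @^-1` A).
  by rewrite -[X in measurable X]setTI; exact: measurable_householder.
rewrite !uX// -{1}(preimage_householder_hypersphere v) -preimage_setI.
rewrite hausdorff_measure_isometric_involution//.
  exact: householderK.
exact: euclid_dist_householder.
Qed.

Lemma uniform_setI_sphere A : measurable A ->
  distribution P X (A `&` hypersphere r) = distribution P X A.
Proof.
move=> mA; rewrite !uX//; last by apply: measurableI => //; exact: measurable_hypersphere.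
by rewrite -setIA setIid.
Qed.

Lemma uniform_sphere1 : distribution P X (hypersphere r) = 1%E.
Proof.
by rewrite -[hypersphere r]setTI uniform_setI_sphere// probability_setT.
Qed.

End law.
End geometry.

(** * Coordinate moments of an invariant law on the sphere *)

(** The constant coefficient is carried along because it feeds the coefficient of degree 2 in the
    induction. *)
Lemma coef2_one_add_sqr (R : nzRingType) m :
  ((1 + 'X^2 : {poly R}) ^+ m)`_0 = 1 /\ ((1 + 'X^2 : {poly R}) ^+ m)`_2 = m%:R.
Proof.
elim: m => [|m [h0 h2]]; first by rewrite expr0 !coefC.
rewrite exprSr mulrDr mulr1 !coefD !coefMXn/= h0 h2 addr0.
by split=> //; rewrite natr1.
Qed.

(** In characteristic zero the integers below [size (p - q)] are distinct roots of [p - q], more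
    than its degree allows. *)
Lemma eq_horner_poly (R : numDomainType) (p q : {poly R}) :
  (forall t, p.[t] = q.[t]) -> p = q.
Proof.
move=> pq; apply/eqP; rewrite -subr_eq0; apply/eqP.
pose s := [seq i%:R : R | i <- iota 0 (size (p - q))].
apply: (@roots_geq_poly_eq0 _ _ s).
- by apply/allP => x _; rewrite rootE hornerD hornerN pq subrr.
- rewrite map_inj_uniq ?iota_uniq// => i j /eqP; rewrite eqr_nat => /eqP //.
- by rewrite size_map size_iota.
Qed.

Section invariant_law.
Context {R : realType} {N : nat}.
Variables (mu : probability (N.-tuple R) R) (r : R).
Hypothesis r0 : 0 < r.
Hypothesis mu_inv : forall v (A : set (N.-tuple R)), measurable A ->
  mu (householder v @^-1` A) = mu A.
Hypothesis mu_sphere : mu (hypersphere r) = 1%E.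

Let S := @hypersphere R N r.
Let mS : measurable S := measurable_hypersphere r.

Definition coord_vec (i : 'I_N) : N.-tuple R := [tuple (k == i)%:R | k < N].

Lemma dotp_coord_vec i x : dotp (coord_vec i) x = tnth x i.
Proof.
rewrite /dotp (bigD1 i)//= tnth_mktuple eqxx mul1r big1 ?addr0// => k.
by rewrite tnth_mktuple => /negbTE ->; rewrite mul0r.
Qed.

Lemma sphere_coord_le (x : N.-tuple R) i : S x -> `|tnth x i| <= r.
Proof.
rewrite /S /hypersphere/= => xr; rewrite -(ger0_norm (ltW r0)) -ler_sqr ?nnegrE//.
rewrite !real_normK ?num_real// -xr (bigD1 i)//= lerDl.
by apply: sumr_ge0 => j _; exact: sqr_ge0.
Qed.

Lemma integrable_sphere (f : N.-tuple R -> R) (M : R) : measurable_fun setT f ->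
  (forall x, S x -> `|f x| <= M) -> mu.-integrable S (EFin \o f).
Proof.
move=> mf fM; apply: measurable_bounded_integrable => //.
- exact: le_lt_trans (probability_le1 mu mS) (ltry _).
- exact: measurable_funTS.
- exists M; split; first exact: num_real.
  by move=> y My x Sx; exact: le_trans (fM _ Sx) (ltW My).
Qed.

Lemma integrable_dotp_expr a n :
  mu.-integrable S (fun x => (dotp a x ^+ n)%:E).
Proof.
apply: (@integrable_sphere _ ((\sum_(i < N) `|tnth a i| * r) ^+ n)).
  by apply: measurable_funX; exact: measurable_dotp.
move=> x Sx; rewrite normrX lerXn2r ?nnegrE//.
  by apply: sumr_ge0 => i _; rewrite mulr_ge0// ltW.
apply: le_trans (ler_norm_sum _ _ _) _; apply: ler_sum => i _.
by rewrite normrM ler_wpM2l// sphere_coord_le.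
Qed.

Lemma integrable_coordM i j m n :
  mu.-integrable S (fun x => (tnth x i ^+ m * tnth x j ^+ n)%:E).
Proof.
apply: (@integrable_sphere _ (r ^+ m * r ^+ n)).
  by apply: measurable_funM; apply: measurable_funX; exact: measurable_tnth.
move=> x Sx; rewrite normrM !normrX ler_pM ?exprn_ge0//;
  by rewrite lerXn2r ?nnegrE ?(ltW r0)// sphere_coord_le.
Qed.

Lemma Rintegral_householder v (f : N.-tuple R -> R) : measurable_fun setT f ->
  mu.-integrable S (fun x => (f (householder v x))%:E) ->
  \int[mu]_(x in S) f (householder v x) = \int[mu]_(x in S) f x.
Proof.
move=> mf fi; rewrite /Rintegral; congr fine.
rewrite [RHS](eq_measure_integral (pushforward mu (householder v))); last first.
  by move=> A mA _; exact: esym (mu_inv v mA).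
rewrite integral_pushforward//.
- by rewrite preimage_householder_hypersphere.
- exact/measurable_EFinP.
- by rewrite preimage_householder_hypersphere.
Qed.

(** A reflection carries [b] to [a]; being self-adjoint it can be moved onto [x], where the
    invariance of [mu] absorbs it. *)
Lemma Rintegral_dotp_expr a b n : dotp a a = dotp b b ->
  \int[mu]_(x in S) (dotp a x ^+ n) = \int[mu]_(x in S) (dotp b x ^+ n).
Proof.
move=> ab; pose v : N.-tuple R := [tuple tnth b i - tnth a i | i < N].
rewrite -(householder_swap (esym ab)) -/v.
under eq_Rintegral do rewrite dotp_householder_sym.
apply: (@Rintegral_householder v (fun x => dotp b x ^+ n)).
  by apply: measurable_funX; exact: measurable_dotp.
under eq_fun do rewrite -dotp_householder_sym.
exact: integrable_dotp_expr.
Qed.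

(** The vectors [e_i + t e_j] and [s e_i] with [s = sqrt (1 + t^2)] have the same norm, so their
    linear forms have the same moments. The even exponent turns [s ^ (2m)] into a polynomial in
    [t]. *)
Lemma Rintegral_pencil i j m t : i != j ->
  \int[mu]_(x in S) ((tnth x i + t * tnth x j) ^+ (2 * m)) =
  (1 + t ^+ 2) ^+ m * \int[mu]_(x in S) (tnth x i ^+ (2 * m)).
Proof.
move=> ij; set s := Num.sqrt (1 + t ^+ 2).
have s2 : s ^+ 2 = 1 + t ^+ 2 by rewrite sqr_sqrtr// addr_ge0// sqr_ge0.
(* [a] is [e_i + t e_j] and [b] is [s e_i], both written as differences so that [dotp_subZl]
   applies. *)
pose a : N.-tuple R :=
  [tuple tnth (coord_vec i) k - (- t) * tnth (coord_vec j) k | k < N].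
pose b : N.-tuple R :=
  [tuple tnth (coord_vec i) k - (1 - s) * tnth (coord_vec i) k | k < N].
have aE x : dotp a x = tnth x i + t * tnth x j.
  rewrite (@dotp_subZl _ _ (coord_vec i) x (coord_vec j) a (- t)).
    by rewrite !dotp_coord_vec; ring.
  by move=> k; rewrite tnth_mktuple.
have bE x : dotp b x = s * tnth x i.
  rewrite (@dotp_subZl _ _ (coord_vec i) x (coord_vec i) b (1 - s)).
    by rewrite !dotp_coord_vec; ring.
  by move=> k; rewrite tnth_mktuple.
under eq_Rintegral do rewrite -aE.
rewrite (@Rintegral_dotp_expr a b); last first.
  rewrite aE bE !tnth_mktuple !eqxx (eq_sym j i) (negbTE ij) /=.
  by transitivity (1 + t ^+ 2); [ring|rewrite -s2; ring].
under eq_Rintegral do rewrite bE exprMn.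
rewrite RintegralZl//; last first.
  have := integrable_coordM i i (2 * m) 0.
  by under eq_fun do rewrite expr0 mulr1.
by rewrite exprM s2.
Qed.

(** Both sides of [Rintegral_pencil] with [m = k + 1] are polynomials in [t]. The coefficients of
    [t^2] are ['C(2k + 2, 2) = (k + 1)(2k + 1)] times the mixed moment, and [(k + 1)] times the pure
    one. *)
Lemma Rintegral_coord_sqr i j k : i != j ->
  (k.*2.+1)%:R * \int[mu]_(x in S) (tnth x i ^+ (2 * k) * tnth x j ^+ 2) =
  \int[mu]_(x in S) (tnth x i ^+ (2 * k.+1)).
Proof.
move=> ij; set M := RHS.
pose n := (2 * k.+1)%N.
pose c l := 'C(n, l)%:R * \int[mu]_(x in S) (tnth x i ^+ (n - l) * tnth x j ^+ l).
have cE t : (\poly_(l < n.+1) c l).[t] = (M *: (1 + 'X^2) ^+ k.+1).[t].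
  rewrite horner_poly hornerZ horner_exp hornerD hornerXn hornerC.
  rewrite [RHS]mulrC -(Rintegral_pencil _ _ ij) -/n.
  transitivity (\int[mu]_(x in S) \sum_(l < n.+1)
      (t ^+ l * 'C(n, l)%:R) * (tnth x i ^+ (n - l) * tnth x j ^+ l)).
    rewrite Rintegral_sum//.
      apply: eq_bigr => l _; rewrite /c RintegralZl//; first ring.
      exact: integrable_coordM.
    move=> l; rewrite (_ : _ \o _ = fun x => ((t ^+ l * 'C(n, l)%:R)%:E *
      (tnth x i ^+ (n - l) * tnth x j ^+ l)%:E)%E)//.
    by apply: integrableZl => //; exact: integrable_coordM.
  apply: eq_Rintegral => x _; rewrite exprDn; apply: eq_bigr => l _.
  by rewrite exprMn -mulr_natr; ring.
have := congr1 (fun p : {poly R} => p`_2) (eq_horner_poly cE).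
rewrite /= coef_poly coefZ (coef2_one_add_sqr _ k.+1).2.
rewrite (_ : (2 < n.+1)%N); last by rewrite /n mulnS.
rewrite /c (_ : 'C(n, 2) = (k.+1 * k.*2.+1)%N); last first.
  by rewrite bin2 /n mul2n -doubleMl doubleK doubleS.
rewrite (_ : (n - 2)%N = (2 * k)%N); last by rewrite /n mulnS addKn.
(* The common factor [k + 1] cancels. *)
rewrite natrM -mulrA [RHS]mulrC => /mulfI; apply.
by rewrite pnatr_eq0.
Qed.

(** Replace [r^2] by the sum of the squared coordinates. After multiplication by [2k + 1], the term
    [j = i] contributes [(2k + 1) M] and each of the [N - 1] others contributes [M]. *)
Lemma sphere_moment_rec i k :
  (k.*2.+1)%:R * r ^+ 2 * \int[mu]_(x in S) (tnth x i ^+ (2 * k)) =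
  (k.*2 + N)%:R * \int[mu]_(x in S) (tnth x i ^+ (2 * k.+1)).
Proof.
set M := \int[mu]_(x in S) (tnth x i ^+ (2 * k.+1)).
have -> : (k.*2.+1)%:R * r ^+ 2 * \int[mu]_(x in S) (tnth x i ^+ (2 * k)) =
  (k.*2.+1)%:R * \sum_(j < N) \int[mu]_(x in S)
    (tnth x i ^+ (2 * k) * tnth x j ^+ 2).
  rewrite -mulrA; congr (_ * _); rewrite -Rintegral_sum//; last first.
    by move=> j; exact: integrable_coordM.
  rewrite -RintegralZl//; last first.
    have := integrable_coordM i i (2 * k) 0.
    by under eq_fun do rewrite expr0 mulr1.
  apply: eq_Rintegral => x; rewrite inE /S /hypersphere/= => <-.
  by rewrite mulrC mulr_sumr.
rewrite mulr_sumr (bigD1 i)//= (eq_bigr (fun=> M)); last first.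
  by move=> j ji; rewrite Rintegral_coord_sqr// eq_sym.
rewrite sumr_const cardC1 card_ord.
rewrite (_ : \int[mu]_(x in S) _ = M); last first.
  by apply: eq_Rintegral => x _; rewrite -exprD mulnS addnC.
have N0 : (0 < N)%N by exact: leq_ltn_trans (leq0n i) (ltn_ord i).
rewrite -mulr_natr -[in RHS](prednK N0) addnS -addSn natrD; ring.
Qed.

(** The recursion for [Z = (y_i / r)^2]; the factor [1] is the constant density, in the shape used
    by the determinacy lemmas. *)
Lemma sphere_moment_sqr_rec i k :
  (k.*2.+1)%:R * \int[mu]_(x in S) (1 * ((tnth x i / r) ^+ 2) ^+ k) =
  (k.*2 + N)%:R * \int[mu]_(x in S) (1 * ((tnth x i / r) ^+ 2) ^+ k.+1).
Proof.
have E n : \int[mu]_(x in S) (1 * ((tnth x i / r) ^+ 2) ^+ n) =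
    (r ^+ (2 * n))^-1 * \int[mu]_(x in S) (tnth x i ^+ (2 * n)).
  rewrite -RintegralZl//; last first.
    have := integrable_coordM i i (2 * n) 0.
    by under eq_fun do rewrite expr0 mulr1.
  by apply: eq_Rintegral => x _; rewrite mul1r -exprM expr_div_n mulrC.
rewrite !E mulrCA [RHS]mulrCA -sphere_moment_rec mulnS exprD.
by field; rewrite !expf_neq0// gt_eqF.
Qed.

End invariant_law.

(** * Determinacy by moments on the unit interval *)

Section determinacy.
Context {R : realType}.

(** Polynomial approximations of the indicator of [x <= t], of the kind used in elementary proofs of
    the Stone-Weierstrass theorem. The affine map [x |-> (x + 2 - t) / 4] sends [[0, 1]] into
    [[0, 1]] and [t] to the threshold [1/2]. *)
Definition step_poly (t : R) (n : nat) : {poly R} :=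
  (1 - ((4^-1)%:P * ('X + (2 - t)%:P)) ^+ (n * n + n)) ^+ (2 ^ (n * n)).

Lemma horner_step_poly t n x : (step_poly t n).[x] =
  (1 - ((x + 2 - t) / 4) ^+ (n * n + n)) ^+ (2 ^ (n * n)).
Proof.
rewrite /step_poly !(horner_exp, hornerM, hornerD, hornerN, hornerC, hornerX).
by rewrite mulrC addrA.
Qed.

Lemma one_sub_expr_ge (u : R) n : 0 <= u <= 1 -> 1 - n%:R * u <= (1 - u) ^+ n.
Proof.
move=> /andP[u0 u1]; elim: n => [|n ih]; first by rewrite expr0 mul0r subr0.
rewrite exprS (le_trans _ (ler_wpM2l _ ih)) ?subr_ge0//.
rewrite -natr1; have : 0 <= n%:R :> R by []; nra.
Qed.

Lemma one_sub_expr_le (u : R) n : 0 <= u <= 1 ->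
  (1 - u) ^+ n * (1 + n%:R * u) <= 1.
Proof.
move=> /andP[u0 u1]; elim: n => [|n]; first by rewrite expr0 mul0r addr0 mul1r.
apply: le_trans; rewrite exprSr -mulrA ler_wpM2l ?exprn_ge0 ?subr_ge0//.
rewrite -natr1; have : 0 <= n%:R :> R by []; nra.
Qed.

(** This uniform bound also supplies the domination when limits are taken under the integral. *)
Lemma step_itv01 (y : R) a b : 0 <= y <= 1 -> 0 <= (1 - y ^+ a) ^+ b <= 1.
Proof.
move=> /andP[y0 y1]; have y1' : 0 <= 1 - y ^+ a by rewrite subr_ge0 exprn_ile1.
by rewrite exprn_ge0// exprn_ile1// gerBl exprn_ge0.
Qed.

Lemma cvg_half_expr : (2^-1 : R) ^+ n @[n --> \oo] --> (0 : R).
Proof. by apply: cvg_expr; rewrite ger0_norm; lra. Qed.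

(* The exponents are chosen so that [2 ^ (n * n) * y ^ (n * n + n)] tends to
   [0] for [y <= 1/2], the threshold included, and to infinity for [y > 1/2]. *)
Lemma cvg_step (y : R) : 0 <= y <= 1 ->
  (1 - y ^+ (n * n + n)) ^+ (2 ^ (n * n)) @[n --> \oo] -->
  ((y <= 2^-1)%R%:R : R).
Proof.
move=> y01; have /andP[y0 y1] := y01.
have z01 n : 0 <= y ^+ n <= 1 by rewrite exprn_ge0//= exprn_ile1.
case: leP => hy /=.
  (* For [y <= 1/2], Bernoulli's inequality applies with [2^(n n) y^(n n + n) = (2y)^(n n) y^n <=
     2^-n]. *)
  apply: (@squeeze_cvgr _ _ _ _ (fun n => 1 - 2^-1 ^+ n) (cst 1)).
  - apply: nearW => n; have /andP[_ ->] := @step_itv01 y (n * n + n) (2 ^ (n * n)) y01.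
    rewrite andbT (le_trans _ (one_sub_expr_ge _ (z01 _)))// lerB//.
    rewrite natrX exprD mulrA -exprMn.
    rewrite -[leRHS]mul1r ler_pM ?exprn_ge0 ?mulr_ge0//.
      by rewrite exprn_ile1//; lra.
    by rewrite lerXn2r ?nnegrE//; lra.
  - by rewrite -[X in _ --> X]subr0; apply: cvgB; [exact: cvg_cst|exact: cvg_half_expr].
  - exact: cvg_cst.
apply: (@squeeze_cvgr _ _ _ _ (cst 0) (fun n => 2^-1 ^+ n)); last 2 first.
- exact: cvg_cst.
- exact: cvg_half_expr.
have q0 : 0 < 2 * y by lra.
have qn : ((2 * y)^-1) ^+ n @[n --> \oo] --> (0 : R).
  apply: cvg_expr; rewrite ger0_norm ?invr_ge0 ?(ltW q0)//.
  by rewrite invf_lt1//; lra.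
(* For [y > 1/2] this says that eventually [(2y)^n y > 2]; its [n]-th power bounds
   [2^(n n) y^(n n + n)] below by [2^n], so the step value is at most [2^-n]. *)
have : \forall n \near \oo, ((2 * y)^-1) ^+ n < y / 2.
  by move/cvgr_lt : qn; apply; lra.
apply: filterS => n hn.
have /andP[-> _] /= := @step_itv01 y (n * n + n) (2 ^ (n * n)) y01.
set p := _ ^+ (2 ^ _).
have := one_sub_expr_le (2 ^ (n * n)) (z01 (n * n + n)%N); rewrite -/p.
have -> : (2 ^ (n * n))%:R * y ^+ (n * n + n) = ((2 * y) ^+ n * y) ^+ n.
  by rewrite natrX exprD mulrA -exprMn [RHS]exprMn -exprM.
have h : 2 ^+ n <= ((2 * y) ^+ n * y) ^+ n.
  rewrite lerXn2r ?nnegrE//; first by rewrite mulr_ge0// exprn_ge0// ltW.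
  move: hn; rewrite exprVn -[X in X < _]mul1r ltr_pdivrMr ?exprn_gt0//; lra.
have p0 : 0 <= p by have /andP[] := @step_itv01 y (n * n + n) (2 ^ (n * n)) y01.
move=> hp; rewrite exprVn -[leRHS]mul1r ler_pdivlMr ?exprn_gt0//.
by apply: le_trans hp; rewrite ler_wpM2l//; lra.
Qed.

Lemma cvg_step_poly (t x : R) : 0 <= t <= 1 -> 0 <= x <= 1 ->
  (step_poly t n).[x] @[n --> \oo] --> ((x <= t)%R%:R : R).
Proof.
move=> t01 x01; under eq_fun do rewrite horner_step_poly.
rewrite (_ : (x <= t) = ((x + 2 - t) / 4 <= 2^-1)).
  by apply: cvg_step; apply/andP; split; lra.
by apply/idP/idP; lra.
Qed.

Lemma step_poly_itv01 (t x : R) n : 0 <= t <= 1 -> 0 <= x <= 1 ->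
  0 <= (step_poly t n).[x] <= 1.
Proof.
by move=> t01 x01; rewrite horner_step_poly step_itv01//; apply/andP; split; lra.
Qed.

(** * Polynomial integrals against a single density *)

Section one_density.
Context {d : measure_display} {T : measurableType d}.
Variables (mu : {measure set T -> \bar R}) (D : set T) (w Z : T -> R).
Hypotheses (mD : measurable D) (iw : mu.-integrable D (EFin \o w)).
Hypotheses (mZ : measurable_fun D Z) (Z01 : forall x, D x -> 0 <= Z x <= 1).

Lemma measurable_density : measurable_fun D w.
Proof. by apply/measurable_EFinP; exact: measurable_int iw. Qed.

Lemma measurable_density_poly (q : {poly R}) :
  measurable_fun D (fun x => w x * q.[Z x]).
Proof.
apply: measurable_funM; first exact: measurable_density.
by apply: (measurableT_comp _ mZ); exact: measurable_poly.
Qed.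

(** Dominated convergence: the step polynomials take values in [[0, 1]] on the range of [Z], so
    [|w|] dominates. *)
Lemma cvg_integral_step_poly t : 0 <= t <= 1 ->
  \int[mu]_(x in D) (w x * (step_poly t n).[Z x]) @[n --> \oo] -->
  \int[mu]_(x in D `&` [set x | Z x <= t]) w x.
Proof.
move=> t01; rewrite Rintegral_mkcondr.
pose g x := w x * (Z x <= t)%R%:R.
have -> : \int[mu]_(x in D) (w \_ [set x | Z x <= t]) x = \int[mu]_(x in D) g x.
  apply: eq_Rintegral => x _; rewrite patchE /g.
  have [h|h] := boolP (Z x <= t); first by rewrite mem_set// mulr1.
  by rewrite memNset ?mulr0//=; exact/negP.
have mg : measurable_fun D g.
  apply: measurable_funM; first exact: measurable_density.
  apply: (@measurableT_comp _ _ _ _ _ _ (fun b : bool => b%:R : R)) => //.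
  by apply: measurable_fun_ler => //; exact: measurable_cst.
have [] := @dominated_convergence _ _ _ mu D mD
  (fun n x => (w x * (step_poly t n).[Z x])%:E) (EFin \o g) (abse \o (EFin \o w)).
- by move=> n; apply/measurable_EFinP; exact: measurable_density_poly.
- exact/measurable_EFinP.
- apply: aeW => x Dx; apply/cvg_EFin; first by apply: nearW.
  by apply: cvgM; [exact: cvg_cst|exact/cvg_step_poly/Z01].
- exact: integrable_abse.
- apply: aeW => x n Dx /=; rewrite lee_fin normrM.
  have /andP[p0 p1] := @step_poly_itv01 t _ n t01 (Z01 Dx).
  by rewrite (ger0_norm p0) ler_piMr.
move=> ig _ h; apply: fine_cvg.
by rewrite fineK; [exact: h|exact: integrable_fin_num].
Qed.

Lemma integrable_density_expr n : mu.-integrable D (fun x => (w x * Z x ^+ n)%:E).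
Proof.
apply: le_integrable (iw) => //.
  apply/measurable_EFinP; apply: measurable_funM; first exact: measurable_density.
  exact: measurable_funX.
move=> x Dx /=; rewrite lee_fin normrM ler_piMr// normrX exprn_ile1//.
by have /andP[z0 z1] := Z01 Dx; rewrite ger0_norm.
Qed.

Lemma Rintegral_density_poly (q : {poly R}) :
  \int[mu]_(x in D) (w x * q.[Z x]) =
  \sum_(i < size q) q`_i * \int[mu]_(x in D) (w x * Z x ^+ i).
Proof.
transitivity (\int[mu]_(x in D) \sum_(i < size q) q`_i * (w x * Z x ^+ i)).
  apply: eq_Rintegral => x _; rewrite horner_coef mulr_sumr.
  by apply: eq_bigr => i _; ring.
have ie (i : 'I_(size q)) :
    mu.-integrable D (fun x => (q`_i * (w x * Z x ^+ i))%:E).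
  under eq_fun do rewrite EFinM.
  by apply: integrableZl => //; exact: integrable_density_expr.
rewrite Rintegral_sum//; apply: eq_bigr => i _.
by rewrite -RintegralZl//; exact: integrable_density_expr.
Qed.

End one_density.

(** * Comparison of two densities with equal moments *)

Context {d1 d2 : measure_display} {T1 : measurableType d1} {T2 : measurableType d2}.
Variables (mu1 : {measure set T1 -> \bar R}) (D1 : set T1) (w1 Z1 : T1 -> R).
Variables (mu2 : {measure set T2 -> \bar R}) (D2 : set T2) (w2 Z2 : T2 -> R).
Hypotheses (mD1 : measurable D1) (iw1 : mu1.-integrable D1 (EFin \o w1)).
Hypotheses (mZ1 : measurable_fun D1 Z1) (Z101 : forall x, D1 x -> 0 <= Z1 x <= 1).
Hypotheses (mD2 : measurable D2) (iw2 : mu2.-integrable D2 (EFin \o w2)).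
Hypotheses (mZ2 : measurable_fun D2 Z2) (Z201 : forall x, D2 x -> 0 <= Z2 x <= 1).
Hypothesis moments : forall n,
  \int[mu1]_(x in D1) (w1 x * Z1 x ^+ n) = \int[mu2]_(x in D2) (w2 x * Z2 x ^+ n).

(** Equal moments give equal integrals of every step polynomial, so the two sides are limits of one
    sequence. *)
Lemma moments_determine_le t : 0 <= t <= 1 ->
  \int[mu1]_(x in D1 `&` [set x | Z1 x <= t]) w1 x =
  \int[mu2]_(x in D2 `&` [set x | Z2 x <= t]) w2 x.
Proof.
move=> t01; have h1 := cvg_integral_step_poly mD1 iw1 mZ1 Z101 t01.
have h2 := cvg_integral_step_poly mD2 iw2 mZ2 Z201 t01.
apply: cvg_unique h1 _ => //; apply: cvg_trans h2; apply: near_eq_cvg.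
apply: nearW => n; rewrite !Rintegral_density_poly//.
by apply: eq_bigr => i _; rewrite moments.
Qed.

End determinacy.

(** Apply the previous lemma to [1 - Z] at level [1 - t]; the moments of [1 - Z] are polynomial
    integrals in [Z]. The superlevel set stays closed, so no discussion of atoms arises. *)
Lemma moments_determine_ge {R : realType} {d1 d2 : measure_display}
    {T1 : measurableType d1} {T2 : measurableType d2}
    (mu1 : {measure set T1 -> \bar R}) (D1 : set T1) (w1 Z1 : T1 -> R)
    (mu2 : {measure set T2 -> \bar R}) (D2 : set T2) (w2 Z2 : T2 -> R) (t : R) :
  measurable D1 -> mu1.-integrable D1 (EFin \o w1) -> measurable_fun D1 Z1 ->
  (forall x, D1 x -> 0 <= Z1 x <= 1) ->
  measurable D2 -> mu2.-integrable D2 (EFin \o w2) -> measurable_fun D2 Z2 ->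
  (forall x, D2 x -> 0 <= Z2 x <= 1) ->
  (forall n, \int[mu1]_(x in D1) (w1 x * Z1 x ^+ n) =
             \int[mu2]_(x in D2) (w2 x * Z2 x ^+ n)) ->
  0 <= t <= 1 ->
  \int[mu1]_(x in D1 `&` [set x | t <= Z1 x]) w1 x =
  \int[mu2]_(x in D2 `&` [set x | t <= Z2 x]) w2 x.
Proof.
move=> mD1 iw1 mZ1 Z101 mD2 iw2 mZ2 Z201 moments t01.
have geE d (T : measurableType d) (Z : T -> R) :
    [set x | t <= Z x] = [set x | 1 - Z x <= 1 - t].
  by apply/seteqP; split => x /=; lra.
rewrite !geE; apply: moments_determine_le => //.
- by apply: measurable_funB => //; exact: measurable_cst.
- by move=> x /Z101; lra.
- by apply: measurable_funB => //; exact: measurable_cst.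
- by move=> x /Z201; lra.
- move=> n; pose q : {poly R} := (1 - 'X) ^+ n.
  have qE z : (1 - z) ^+ n = q.[z] by rewrite /q !hornerE.
  under eq_Rintegral do rewrite qE.
  under [RHS]eq_Rintegral do rewrite qE.
  rewrite !Rintegral_density_poly//.
  by apply: eq_bigr => i _; rewrite moments.
- lra.
Qed.

(** * Moments of the beta density *)

Section beta_density.
Context {R : realType}.
Notation leb := (@lebesgue_measure R).
Implicit Types (a b t : R).

Definition beta_weight a b t : R := t `^ (a - 1) * (1 - t) `^ (b - 1).

(** * Calculus on the open unit interval *)

Lemma is_derive_powR_onem b t : t < 1 ->
  is_derive t 1 (fun u => (1 - u) `^ b) (- (b * (1 - t) `^ (b - 1))).
Proof.
move=> t1; have h : is_derive (1 - t) 1 (@powR R ^~ b) (b * (1 - t) `^ (b - 1)).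
  by apply: is_derive1_powR; rewrite subr_gt0.
have g : is_derive t 1 (fun u : R => 1 - u) (-1 : R).
  by apply: is_derive_eq; rewrite add0r mul1r.
rewrite -[- (b * _)]mulrN1.
exact: (@is_derive1_comp _ (@powR R ^~ b) (fun u => 1 - u) _ _ _ h g).
Qed.

Lemma is_derive_powRM a b t : 0 < t < 1 ->
  is_derive t 1 (fun u => u `^ a * (1 - u) `^ b)
    (a * t `^ (a - 1) * (1 - t) `^ b - b * t `^ a * (1 - t) `^ (b - 1)).
Proof.
move=> /andP[t0 t1]; have h := is_derive1_powR a t0.
have g := is_derive_powR_onem b t1.
have hg := is_deriveM h g.
rewrite (_ : _ - _ = t `^ a *: - (b * (1 - t) `^ (b - 1)) +
  (1 - t) `^ b *: (a * t `^ (a - 1))); first exact: hg.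
by rewrite /GRing.scale/=; ring.
Qed.

Lemma integral_FTC_itv01 (f F : R -> R) (c e : R) : 0 < c -> c < e -> e < 1 ->
  (forall t, 0 < t < 1 -> derivable f t 1) ->
  (forall t, 0 < t < 1 -> is_derive t 1 F (f t)) ->
  (\int[leb]_(t in `[c, e]) (f t)%:E = (F e - F c)%:E)%E.
Proof.
move=> c0 ce e1 df dF; rewrite EFinB; apply: continuous_FTC2 => //.
- apply: derivable_within_continuous => t; rewrite in_itv/= => /andP[? ?].
  by apply: df; apply/andP; split; lra.
- have cF t : 0 < t < 1 -> {for t, continuous F}.
    by move=> /dF h; apply: differentiable_continuous; apply/derivable1_diffP.
  split.
  + move=> t; rewrite in_itv/= => /andP[? ?].
    by have h : is_derive t 1 F (f t) by [apply: dF; apply/andP; split; lra].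
  + by apply: cvg_at_right_filter; apply: cF; apply/andP; split; lra.
  + by apply: cvg_at_left_filter; apply: cF; apply/andP; split; lra.
- move=> t; rewrite in_itv/= => /andP[? ?]; rewrite derive1E.
  have h : is_derive t 1 F (f t) by apply: dF; apply/andP; split; lra.
  exact: derive_val.
Qed.

(** The beta density may be singular at 0 and 1, so integrals are computed on [[eps n, 1 - eps n]]
    and passed to the limit. Division by 3 keeps [eps n < 1 - eps n] from [n = 0] on. *)
Definition eps n : R := harmonic n / 3.

Lemma eps_itv n : 0 < eps n <= 3^-1.
Proof.
rewrite /eps /harmonic/= divr_gt0//= ler_piMl//.
by rewrite invf_le1// ler1n.
Qed.

Lemma cvg_eps : eps n @[n --> \oo] --> (0 : R).
Proof.
rewrite -[X in _ --> X](mul0r 3^-1).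
by apply: cvgMr_tmp; exact: cvg_harmonic.
Qed.

Definition inner_itv n : set R := `[eps n, 1 - eps n].

Lemma bigcup_inner_itv : \bigcup_n inner_itv n = [set` `]0 : R, 1[].
Proof.
apply/seteqP; split => t.
  move=> [n _]; rewrite /inner_itv/= !in_itv/= => /andP[? ?].
  by have := eps_itv n; move=> /andP[? ?]; apply/andP; split; lra.
rewrite /= in_itv/= => /andP[t0 t1].
have : \forall n \near \oo, eps n < t by move/cvgr_lt : cvg_eps; apply.
have : \forall n \near \oo, eps n < 1 - t.
  by move/cvgr_lt : cvg_eps; apply; rewrite subr_gt0.
move=> h1 h2; have [n _ h] := filterI h1 h2.
have /= [? ?] := h n (leqnn n).
by exists n => //; rewrite /inner_itv/= in_itv/=; apply/andP; split; lra.
Qed.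

Lemma measurable_inner_itv n : measurable (inner_itv n).
Proof. exact: measurable_itv. Qed.

Lemma nondecreasing_inner_itv : nondecreasing_seq inner_itv.
Proof.
move=> m n mn; rewrite subsetEset /inner_itv => t /=; rewrite !in_itv/=.
have le : eps n <= eps m.
  by rewrite /eps ler_wpM2r// /harmonic/= lef_pV2 ?posrE// ler_nat.
by move=> /andP[? ?]; apply/andP; split; lra.
Qed.

(** Monotone convergence over the increasing intervals, whose union is []0, 1[]; the two endpoints
    form a null set. *)
Lemma cvg_integral_inner_itv (f : R -> R) : measurable_fun setT f ->
  (forall t, 0 <= f t) ->
  (\int[leb]_(t in inner_itv n) (f t)%:E @[n --> \oo] -->
   \int[leb]_(t in `[0%R, 1%R]) (f t)%:E)%E.
Proof.
move=> mf f0; rewrite integral_itv_bndoo; last first.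
  by apply/measurable_EFinP; exact: measurable_funTS.
rewrite -bigcup_inner_itv; apply: ge0_nondecreasing_set_cvg_integral.
- exact: nondecreasing_inner_itv.
- exact: measurable_inner_itv.
- by move=> n; apply/measurable_EFinP; exact: measurable_funTS.
- by move=> n t _; rewrite lee_fin.
Qed.

(** * Integrability and positivity of the beta weight *)

Lemma beta_weight_ge0 a b t : 0 <= beta_weight a b t.
Proof. by rewrite mulr_ge0// powR_ge0. Qed.

Lemma beta_weight_gt0 a b t : 0 < t < 1 -> 0 < beta_weight a b t.
Proof. by move=> /andP[? ?]; rewrite mulr_gt0// powR_gt0// subr_gt0. Qed.

Lemma measurable_powR_onem b : measurable_fun setT (fun t : R => (1 - t) `^ b).
Proof.
apply: (@measurableT_comp _ _ _ _ _ _ (@powR R ^~ b)); first exact: measurable_powR.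
by apply: measurable_funB => //; exact: measurable_cst.
Qed.

Lemma measurable_beta_weight a b : measurable_fun setT (beta_weight a b).
Proof.
by apply: measurable_funM; [exact: measurable_powR|exact: measurable_powR_onem].
Qed.

(** Since [a >= 1/2], the weight is at most [1 / (u v)] with [u = sqrt t] and [v = sqrt (1 - t)]. As
    [u^2 + v^2 = 1] forces [u + v >= 1], this is at most [1/u + 1/v], which has an elementary
    antiderivative. *)
Lemma beta_weight_le a t : 2^-1 <= a -> 0 < t < 1 ->
  beta_weight a 2^-1 t <= t `^ (2^-1 - 1) + (1 - t) `^ (2^-1 - 1).
Proof.
move=> ha /andP[t0 t1]; rewrite /beta_weight.
set p := t `^ (2^-1 - 1); set q := (1 - t) `^ _.
apply: (@le_trans _ _ (p * q)).
  rewrite ler_wpM2r ?powR_ge0//; apply: ger_powR; first by rewrite t0 ltW.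
  by rewrite lerB.
have p0 : 0 <= p by exact: powR_ge0.
have q0 : 0 <= q by exact: powR_ge0.
pose u := t `^ 2^-1; pose v := (1 - t) `^ 2^-1.
have h0 : 2^-1 - 1 + 2^-1 = 0 :> R by field.
have h1 : 2^-1 + 2^-1 = 1 :> R by field.
have t'0 : 0 < 1 - t by rewrite subr_gt0.
have u1 : p * u = 1 by rewrite /p /u -powRD ?h0 ?powRr0// (gt_eqF t0) ?implybT.
have v1 : q * v = 1 by rewrite /q /v -powRD ?h0 ?powRr0// (gt_eqF t'0) ?implybT.
have u0 : 0 <= u by exact: powR_ge0.
have v0 : 0 <= v by exact: powR_ge0.
have uu : u * u = t by rewrite /u -powRD h1 ?powRr1 ?ltW// (gt_eqF t0) ?implybT.
have vv : v * v = 1 - t by rewrite /v -powRD h1 ?powRr1 ?ltW// (gt_eqF t'0) ?implybT.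
have uv : 1 <= u + v by nra.
have -> : p + q = p * q * (u + v).
  transitivity (p * (q * v) + q * (p * u)); last ring.
  by rewrite u1 v1 !mulr1.
by rewrite ler_peMr// mulr_ge0.
Qed.

Lemma integrable_beta_weight a : 2^-1 <= a ->
  leb.-integrable `[0, 1] (EFin \o beta_weight a 2^-1).
Proof.
move=> ha; apply/integrableP; split.
  by apply/measurable_EFinP/measurable_funTS; exact: measurable_beta_weight.
under eq_integral do rewrite /= ger0_norm ?beta_weight_ge0//.
(* The antiderivative [F] below gives [4 (sqrt (1 - eps n) - sqrt (eps n)) <= 4] on every inner
   interval. *)
apply: (@le_lt_trans _ _ 4%:E); last exact: ltry.
apply: (cvge_to_le (cvg_integral_inner_itv (measurable_beta_weight a 2^-1)
  (beta_weight_ge0 a 2^-1))).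
apply: nearW => n; have /andP[e0 e3] := eps_itv n.
pose f t : R := t `^ (2^-1 - 1) + (1 - t) `^ (2^-1 - 1).
pose F t : R := 2 * t `^ 2^-1 - 2 * (1 - t) `^ 2^-1.
apply: (@le_trans _ _ (\int[leb]_(t in inner_itv n) (f t)%:E)%E).
  apply: ge0_le_integral.
  - exact: measurable_inner_itv.
  - by move=> t _; rewrite lee_fin beta_weight_ge0.
  - by apply/measurable_EFinP/measurable_funTS; exact: measurable_beta_weight.
  - apply/measurable_EFinP/measurable_funTS; apply: measurable_funD.
      exact: measurable_powR.
    exact: measurable_powR_onem.
  - move=> t; rewrite /inner_itv/= in_itv/= => /andP[? ?].
    by rewrite lee_fin beta_weight_le//; apply/andP; split; lra.
have -> : (\int[leb]_(t in inner_itv n) (f t)%:E = (F (1 - eps n) - F (eps n))%:E)%E.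
  apply: integral_FTC_itv01 => [|||t /andP[t0 t1]|t /andP[t0 t1]].
  - exact: e0.
  - lra.
  - lra.
  - have h1 := is_derive1_powR (2^-1 - 1) t0.
    have h2 := is_derive_powR_onem (2^-1 - 1) t1.
    exact: derivableD.
  - have h1 := is_derive1_powR 2^-1 t0; have h2 := is_derive_powR_onem 2^-1 t1.
    have h := is_deriveB (is_deriveZ 2 h1) (is_deriveZ 2 h2).
    rewrite (_ : f t = 2 *: (2^-1 * t `^ (2^-1 - 1)) -
      2 *: - (2^-1 * (1 - t) `^ (2^-1 - 1))); first exact: h.
    by rewrite /f /GRing.scale/=; field.
have h x : 0 <= x <= 1 -> 0 <= (x : R) `^ 2^-1 <= 1.
  move=> /andP[x0 x1]; rewrite powR_ge0/=.
  apply: (@le_trans _ _ (1 `^ 2^-1)); last by rewrite powR1.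
  by apply: ge0_ler_powR; rewrite ?nnegrE// ?invr_ge0.
have /andP[? ?] : 0 <= eps n `^ 2^-1 <= 1 by apply: h; apply/andP; split; lra.
have /andP[? ?] : 0 <= (1 - eps n) `^ 2^-1 <= 1.
  by apply: h; apply/andP; split; lra.
by rewrite lee_fin /F subKr; lra.
Qed.

(** A zero integral would make the weight vanish almost everywhere, but it is positive on []0, 1[],
    which has measure 1. *)
Lemma beta_weight_gt0_int a : 2^-1 <= a ->
  0 < \int[leb]_(t in `[0, 1]) beta_weight a 2^-1 t.
Proof.
move=> ha; have iw := integrable_beta_weight ha.
rewrite lt_neqAle Rintegral_ge0 ?andbT => [|t _]; last exact: beta_weight_ge0.
apply/negP => /eqP /esym h0.
have : (\int[leb]_(t in `[0%R, 1%R]) `|(beta_weight a 2^-1 t)%:E| = 0)%E.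
  under eq_integral do rewrite gee0_abs ?lee_fin ?beta_weight_ge0//.
  rewrite -[LHS]fineK; last by exact: integrable_fin_num.
  by congr EFin.
move/ae_eq_integral_abs; have mw := measurable_int leb iw.
move=> /(_ (measurable_itv _) mw) neg.
have : leb [set` `]0 : R, 1[] = 0%E.
  apply: measure_negligible; first exact: measurable_itv.
  apply: negligibleS neg => t /=; rewrite in_itv/= => /andP[t0 t1] /=.
  rewrite in_itv/= !ltW//= => /(_ isT) /eqP; rewrite eqe gt_eqF//.
  by rewrite beta_weight_gt0// t0.
by rewrite lebesgue_measure_itv/= lte_fin ltr01 sube0 => /eqP; rewrite eqe oner_eq0.
Qed.

(** Integrate the derivative of [g t = t^a (1 - t)^b] with [b = 1/2 + k]. Writing [t = 1 - (1 - t)]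
    turns [- g'] into [b] times the [k]-th integrand minus [a + b] times the next one, and the
    boundary terms vanish in the limit. *)
Lemma beta_moment_rec a k : 2^-1 <= a ->
  (2^-1 + k%:R) * \int[leb]_(t in `[0, 1]) (beta_weight a 2^-1 t * (1 - t) ^+ k) =
  (a + 2^-1 + k%:R) *
    \int[leb]_(t in `[0, 1]) (beta_weight a 2^-1 t * (1 - t) ^+ k.+1).
Proof.
move=> ha; pose b : R := 2^-1 + k%:R.
have iw j : leb.-integrable `[0, 1]
    (EFin \o (fun t => beta_weight a 2^-1 t * (1 - t) ^+ j)).
  apply: (@integrable_density_expr _ _ _ leb `[0, 1] (beta_weight a 2^-1)
    (fun t => 1 - t)) => //.
  - exact: integrable_beta_weight.
  - by apply: measurable_funTS; apply: measurable_funB => //; exact: measurable_cst.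
  - by move=> t; rewrite /= in_itv/=; lra.
(* The absolute value makes the integrand nonnegative on the whole line, as [cvg_integral_inner_itv]
   requires; on [[0, 1]] nothing changes. *)
pose W j t : R := beta_weight a 2^-1 t * `|1 - t| ^+ j.
have WE j : \int[leb]_(t in `[0, 1]) (beta_weight a 2^-1 t * (1 - t) ^+ j) =
    \int[leb]_(t in `[0, 1]) W j t.
  apply: eq_Rintegral => t; rewrite inE/= in_itv/= => /andP[_ t1].
  by rewrite /W ger0_norm ?subr_ge0.
have iW j : leb.-integrable `[0, 1] (EFin \o W j).
  apply: eq_integrable (iw j) => // t; rewrite inE/= in_itv/= => /andP[_ t1].
  by rewrite /W ger0_norm ?subr_ge0.
have cW j : \int[leb]_(t in inner_itv n) W j t @[n --> \oo] -->
    \int[leb]_(t in `[0, 1]) W j t.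
  apply: fine_cvg; rewrite fineK; last by apply: (integrable_fin_num _ (iW j)).
  apply: cvg_integral_inner_itv => [|t]; last by rewrite mulr_ge0// beta_weight_ge0.
  apply: measurable_funM; first exact: measurable_beta_weight.
  apply: measurable_funX; apply: measurableT_comp => //.
  by apply: measurable_funB => //; exact: measurable_cst.
rewrite !WE; apply/eqP; rewrite -subr_eq0; apply/eqP.
pose g t : R := t `^ a * (1 - t) `^ b.
have diffE n : b * \int[leb]_(t in inner_itv n) W k t -
    (a + b) * \int[leb]_(t in inner_itv n) W k.+1 t = g (eps n) - g (1 - eps n).
  have /andP[e0 e3] := eps_itv n.
  have inS : inner_itv n `<=` `[0, 1].
    by move=> t; rewrite /inner_itv/= !in_itv/=; lra.
  have iWn j : leb.-integrable (inner_itv n) (EFin \o W j).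
    by apply: integrableS (iW j) => //; exact: measurable_itv.
  rewrite -!RintegralZl//; try exact: measurable_itv.
  rewrite -RintegralB//; try exact: measurable_itv; last 2 first.
  - by apply: (integrableZl _ _ (iWn k)); exact: measurable_itv.
  - by apply: (integrableZl _ _ (iWn k.+1)); exact: measurable_itv.
  pose f t := b * t `^ a * (1 - t) `^ (b - 1) - a * t `^ (a - 1) * (1 - t) `^ b.
  transitivity (\int[leb]_(t in inner_itv n) f t).
    apply: eq_Rintegral => t; rewrite inE /inner_itv/= in_itv/= => /andP[? ?].
    have t0 : 0 < t by lra.
    have t1 : 0 < 1 - t by lra.
    rewrite /W ger0_norm ?ltW// /beta_weight /f.
    have -> : t `^ a = t * t `^ (a - 1) by rewrite mulr_powRB1// ?ltW//; lra.
    have -> : (1 - t) `^ (b - 1) = (1 - t) `^ (2^-1 - 1) * (1 - t) ^+ k.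
      rewrite -powR_mulrn ?ltW// -powRD ?(gt_eqF t1) ?implybT//.
      by congr (_ `^ _); rewrite /b; ring.
    have -> : (1 - t) `^ b = (1 - t) `^ (2^-1 - 1) * (1 - t) ^+ k.+1.
      rewrite -powR_mulrn ?ltW// -powRD ?(gt_eqF t1) ?implybT//.
      by congr (_ `^ _); rewrite /b -natr1; ring.
    by rewrite exprS; ring.
  rewrite /Rintegral (_ : (\int[leb]_(t in inner_itv n) (f t)%:E =
      (- g (1 - eps n) - - g (eps n))%:E)%E); first by rewrite /= opprK addrC.
  apply: (@integral_FTC_itv01 f (fun t => - g t)).
  - exact: e0.
  - lra.
  - lra.
  - move=> t /andP[t0 t1].
    have t01 : 0 < t < 1 by rewrite t0.
    have h1 := is_derive_powRM a (b - 1) t01.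
    have h2 := is_derive_powRM (a - 1) b t01.
    have h := is_deriveB (is_deriveZ b h1) (is_deriveZ a h2).
    rewrite (_ : f = b \*: (fun u => u `^ a * (1 - u) `^ (b - 1)) -
      a \*: (fun u => u `^ (a - 1) * (1 - u) `^ b)); first exact: (@ex_derive _ _ _ _ _ _ _ h).
    apply/funext => u; rewrite /f -!mulrA.
    by rewrite -[RHS]/(b * (u `^ a * (1 - u) `^ (b - 1)) -
      a * (u `^ (a - 1) * (1 - u) `^ b)).
  - move=> t t01; have h := is_deriveN (is_derive_powRM a b t01).
    rewrite (_ : f t = - (a * t `^ (a - 1) * (1 - t) `^ b -
      b * t `^ a * (1 - t) `^ (b - 1))); first exact: h.
    by rewrite /f; ring.
have lim1 : b * \int[leb]_(t in inner_itv n) W k t -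
    (a + b) * \int[leb]_(t in inner_itv n) W k.+1 t @[n --> \oo] -->
    b * \int[leb]_(t in `[0, 1]) W k t -
    (a + b) * \int[leb]_(t in `[0, 1]) W k.+1 t.
  by apply: cvgB; apply: cvgMl_tmp; exact: cW.
move: lim1; under eq_fun do rewrite diffE.
move=> lim1; rewrite -addrA -/b; apply: cvg_unique lim1 _ => //.
have hb : 2^-1 <= b by rewrite lerDl.
have cs : Num.sqrt (eps n) @[n --> \oo] --> (0 : R).
  rewrite -[X in _ --> X](@sqrtr0 R).
  by apply: continuous_cvg; [exact: sqrt_continuous|exact: cvg_eps].
(* Both exponents of [g] are at least [1/2], so both boundary terms lie between 0 and
   [sqrt (eps n)]. *)
have pw (x c : R) : 0 < x <= 3^-1 -> 2^-1 <= c -> 0 <= x `^ c <= Num.sqrt x.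
  move=> /andP[x0 x1] hc; rewrite powR_ge0/= -(powR12_sqrt (ltW x0)).
  by apply: ger_powR => //; rewrite x0/=; lra.
have pw1 (x c : R) : 0 < x <= 3^-1 -> 2^-1 <= c -> 0 <= (1 - x) `^ c <= 1.
  move=> /andP[x0 x1] hc; rewrite powR_ge0/=.
  apply: (@le_trans _ _ (1 `^ c)); last by rewrite powR1.
  by apply: ge0_ler_powR; rewrite ?nnegrE//; lra.
rewrite /=; apply/norm_cvg0P; apply: (squeeze_cvgr _ (cvg_cst 0) cs).
apply: nearW => n; have e := eps_itv n; rewrite normr_ge0/=.
have /andP[? ?] := pw _ _ e ha; have /andP[? ?] := pw _ _ e hb.
have /andP[? ?] := pw1 _ _ e ha; have /andP[? ?] := pw1 _ _ e hb.
have g1 : 0 <= g (eps n) <= Num.sqrt (eps n).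
  rewrite /g mulr_ge0//= -[leRHS]mulr1; exact: ler_pM.
have g2 : 0 <= g (1 - eps n) <= Num.sqrt (eps n).
  rewrite /g subKr mulr_ge0//= -[leRHS]mul1r; exact: ler_pM.
by rewrite ler_norml; lra.
Qed.

End beta_density.
(** * Measure of a spherical cap *)

Section cap_measure.
Context {R : realType} {N : nat}.
Variables (mu : probability (N.-tuple R) R) (r : R) (i : 'I_N).
Hypotheses (N2 : (2 <= N)%N) (r0 : 0 < r).
Hypothesis mu_inv : forall v (A : set (N.-tuple R)), measurable A ->
  mu (householder v @^-1` A) = mu A.
Hypothesis mu_sphere : mu (hypersphere r) = 1%E.

Notation leb := (@lebesgue_measure R).
Let S := @hypersphere R N r.
Let mS : measurable S := measurable_hypersphere r.
Let muS : mu S = 1%E := mu_sphere.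
Let a : R := (N%:R - 1) / 2.
Let Z (x : N.-tuple R) : R := (tnth x i / r) ^+ 2.
Let B := incomplete_beta 1 a 2^-1.
Let w (t : R) := B^-1 * beta_weight a 2^-1 t.

Let ha : 2^-1 <= a.
Proof.
have : 2%:R <= N%:R :> R by rewrite ler_nat.
by rewrite /a; lra.
Qed.

Let B0 : 0 < B. Proof. exact: beta_weight_gt0_int. Qed.

Let iw : leb.-integrable `[0, 1] (EFin \o w).
Proof.
have h := integrable_beta_weight ha.
have m : measurable (`[0, 1] : set (measurableTypeR R)) by exact: measurable_itv.
exact: (integrableZl m B^-1 h).
Qed.

Let Rintegral_w (D : set R) (f : R -> R) : measurable D -> D `<=` `[0, 1] ->
  leb.-integrable `[0, 1] (EFin \o (fun t => beta_weight a 2^-1 t * f t)) ->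
  \int[leb]_(t in D) (w t * f t) =
  \int[leb]_(t in D) (beta_weight a 2^-1 t * f t) / B.
Proof.
move=> mD D01 fi; under eq_Rintegral do rewrite /w -mulrA.
rewrite RintegralZl//; first by rewrite mulrC.
by apply: integrableS fi => //; exact: measurable_itv.
Qed.

Let measurable_Z : measurable_fun setT Z.
Proof.
apply: measurable_funX; apply: measurable_funM => //; exact: measurable_tnth.
Qed.

Let Z01 x : S x -> 0 <= Z x <= 1.
Proof.
move=> Sx; rewrite /Z sqr_ge0/= expr_div_n ler_pdivrMr ?exprn_gt0// mul1r.
rewrite -[leLHS]real_normK ?num_real// ler_sqr ?nnegrE ?(ltW r0)//.
exact: sphere_coord_le.
Qed.

Let integrable_beta_pow n : leb.-integrable `[0, 1]
  (EFin \o (fun t : R => beta_weight a 2^-1 t * (1 - t) ^+ n)).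
Proof.
apply: (@integrable_density_expr _ _ _ leb `[0, 1] (beta_weight a 2^-1)
  (fun t => 1 - t)) => //.
- exact: integrable_beta_weight.
- by apply: measurable_funTS; apply: measurable_funB => //; exact: measurable_cst.
- by move=> t; rewrite /= in_itv/=; lra.
Qed.

Let integrable_beta_weight1 : leb.-integrable `[0, 1]
  (EFin \o (fun t : R => beta_weight a 2^-1 t * 1)).
Proof.
rewrite (_ : (fun t => _ * 1) = beta_weight a 2^-1).
  exact: integrable_beta_weight.
by apply/funext => t; rewrite mulr1.
Qed.

(** Both sequences start at 1, and since [a = (N - 1) / 2] the two recursions agree up to a factor
    2: [2n + N = 2 (a + 1/2 + n)]. *)
Let moments_eq n : \int[mu]_(x in S) (1 * Z x ^+ n) =
  \int[leb]_(t in `[0, 1]) (w t * (1 - t) ^+ n).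
Proof.
rewrite Rintegral_w//.
elim: n => [|n ih].
  under eq_Rintegral do rewrite expr0 mulr1.
  under [X in _ = X / _]eq_Rintegral do rewrite expr0 mulr1.
  by rewrite Rintegral_cst// [X in fine X]muS mul1r divff// gt_eqF.
have h1 := sphere_moment_sqr_rec r0 mu_inv i n; rewrite -/S in h1.
have h2 := @beta_moment_rec R a n ha.
have n0 : 0 < (n.*2 + N)%:R :> R by rewrite ltr0n addn_gt0 (ltnW N2) orbT.
apply: (mulfI (lt0r_neq0 n0)); rewrite -h1 ih.
have -> : (n.*2 + N)%:R = 2 * (a + 2^-1 + n%:R) :> R.
  by rewrite natrD -mul2n natrM /a; field.
have -> : (n.*2.+1)%:R = 2 * (2^-1 + n%:R) :> R.
  by rewrite -natr1 -mul2n natrM; field.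
by rewrite !mulrA -!(mulrA 2) h2.
Qed.

Let integrable_one : mu.-integrable S (EFin \o (fun=> 1 : R)).
Proof.
by apply: (@integrable_sphere _ _ _ _ _ 1) => [|x _]; rewrite ?normr1.
Qed.

(** [Z] has the law of [1 - t] under the density [w], so the band corresponds to [t <= x]. *)
Lemma band_ge x : 0 <= x <= 1 ->
  fine (mu (S `&` [set y | 1 - x <= Z y])) = reg_incomplete_beta x a 2^-1.
Proof.
move=> x01; rewrite -[LHS]mul1r -Rintegral_cst; last first.
  apply: measurableI => //; rewrite -[X in measurable X]setTI.
  by have := measurable_Z measurableT (measurable_itv `[1 - x, +oo[);
    rewrite set_itvcy.
rewrite (@moments_determine_ge _ _ _ _ _ mu S (fun=> 1) Z leb `[0, 1]%classic w
  (fun t => 1 - t))//.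
- rewrite (_ : _ `&` _ = `[0, x]%classic); last first.
    by apply/seteqP; split => t /=; rewrite !in_itv/=; lra.
  have := @Rintegral_w `[0, x]%classic (fun=> 1) (measurable_itv _).
  under eq_Rintegral do rewrite mulr1.
  under [X in _ = X / _]eq_Rintegral do rewrite mulr1.
  rewrite /reg_incomplete_beta -/B; apply.
    by move=> t /=; rewrite !in_itv/=; lra.
  exact: integrable_beta_weight1.
- exact: measurable_funTS.
- by apply: measurable_funTS; apply: measurable_funB => //; exact: measurable_cst.
- by move=> t; rewrite /= in_itv/=; lra.
- lra.
Qed.

Lemma band_le x : 0 <= x <= 1 ->
  fine (mu (S `&` [set y | Z y <= 1 - x])) = 1 - reg_incomplete_beta x a 2^-1.
Proof.
move=> x01; rewrite -[LHS]mul1r -Rintegral_cst; last first.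
  apply: measurableI => //; rewrite -[X in measurable X]setTI.
  by have := measurable_Z measurableT (measurable_itv `]-oo, 1 - x]);
    rewrite set_itvNyc.
rewrite (@moments_determine_le _ _ _ _ _ mu S (fun=> 1) Z leb `[0, 1]%classic w
  (fun t => 1 - t))//.
- rewrite (_ : _ `&` _ = `[x, 1]%classic); last first.
    by apply/seteqP; split => t /=; rewrite !in_itv/=; lra.
  have ib : leb.-integrable `[0, 1] (EFin \o beta_weight a 2^-1).
    exact: integrable_beta_weight.
  have := @Rintegral_w `[x, 1]%classic (fun=> 1) (measurable_itv _).
  under eq_Rintegral do rewrite mulr1.
  under [X in _ = X / _]eq_Rintegral do rewrite mulr1.
  move=> ->; last 2 first.
  + by move=> t /=; rewrite !in_itv/=; lra.
  + exact: integrable_beta_weight1.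
  (* Dropping the null endpoint [x] lets the integral be written as the one over [[0, 1]] minus the
     one over [[0, x]]. *)
  rewrite -Rintegral_itv_obnd_cbnd; last first.
    apply: integrableS ib; [exact: measurable_itv|exact: measurable_itv|].
    by move=> t /=; rewrite !in_itv/=; lra.
  rewrite -(@Rintegral_itvB R (beta_weight a 2^-1) (BLeft 0) (BRight 1) x ib).
  + by rewrite mulrBl divff ?gt_eqF.
  + by rewrite bnd_simp; lra.
  + by rewrite bnd_simp; lra.
- exact: measurable_funTS.
- by apply: measurable_funTS; apply: measurable_funB => //; exact: measurable_cst.
- by move=> t; rewrite /= in_itv/=; lra.
- lra.
Qed.

Let measurable_coordP (U : set R) : measurable U ->
  measurable (S `&` [set y | U (tnth y i)]).
Proof.
move=> mU; apply: measurableI => //; rewrite -[X in measurable X]setTI.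
exact: (measurable_tnth i measurableT mU).
Qed.

Let fineU (A C : set (N.-tuple R)) : measurable A -> measurable C ->
  A `&` C = set0 -> fine (mu (A `|` C)) = fine (mu A) + fine (mu C).
Proof.
move=> mA mC AC; rewrite measureU// fineD// fin_num_measure//.
Qed.

(** The reflection along [coord_vec i] changes the sign of the [i]-th coordinate only. *)
Let reflect (U : set R) : measurable U ->
  mu (S `&` [set y | U (- tnth y i)]) = mu (S `&` [set y | U (tnth y i)]).
Proof.
move=> mU; rewrite -(mu_inv (coord_vec i) (measurable_coordP mU)).
rewrite preimage_setI preimage_householder_hypersphere; congr (mu (_ `&` _)).
apply/seteqP; split => y /=; rewrite tnth_householder !dotp_coord_vec;
  by rewrite !tnth_mktuple eqxx divr1 mulr1 (_ : _ - _ = - tnth y i)//; ring.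
Qed.

Let ge_sqrZ y c : 0 <= c ->
  (c ^+ 2 <= Z y) = (r * c <= tnth y i) || (r * c <= - tnth y i).
Proof.
move=> c0; rewrite /Z expr_div_n ler_pdivlMr ?exprn_gt0// mulrC -exprMn.
rewrite -[X in _ <= X]real_normK ?num_real// ler_sqr ?nnegrE//; first exact: ler_normr.
by rewrite mulr_ge0// ltW.
Qed.

Let gt_sqrZ y c : 0 <= c ->
  (c ^+ 2 < Z y) = (r * c < tnth y i) || (r * c < - tnth y i).
Proof.
move=> c0; rewrite /Z expr_div_n ltr_pdivlMr ?exprn_gt0// mulrC -exprMn.
rewrite -[X in _ < X]real_normK ?num_real// ltr_sqr ?nnegrE//; first exact: ltr_normr.
by rewrite mulr_ge0// ltW.
Qed.

Let mle c : measurable (S `&` [set y | c <= tnth y i]).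
Proof.
by have := measurable_coordP (measurable_itv `[c, +oo[); rewrite set_itvcy.
Qed.

Let mlt c : measurable (S `&` [set y | c < tnth y i]).
Proof.
by have := measurable_coordP (measurable_itv `]c, +oo[); rewrite set_itvoy.
Qed.

Let mleN c : measurable (S `&` [set y | c <= - tnth y i]).
Proof.
have := measurable_coordP (measurable_itv `]-oo, - c]); rewrite set_itvNyc.
rewrite (_ : [set y | c <= - _] = [set y | tnth y i <= - c])//.
by apply/seteqP; split => y /=; lra.
Qed.

Let mltN c : measurable (S `&` [set y | c < - tnth y i]).
Proof.
have := measurable_coordP (measurable_itv `]-oo, - c[); rewrite set_itvNyo.
rewrite (_ : [set y | c < - _] = [set y | tnth y i < - c])//.
by apply/seteqP; split => y /=; lra.
Qed.

(** For [s > 0] the set [s^2 <= Z] is the disjoint union of two opposite caps, which have equal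
    measure by reflection. *)
Lemma cap_gt0 s : 0 < s <= 1 ->
  fine (mu (S `&` [set y | r * s <= tnth y i])) =
  2^-1 * reg_incomplete_beta (1 - s ^+ 2) a 2^-1.
Proof.
move=> /andP[s0 s1]; have rs : 0 < r * s by exact: mulr_gt0.
have s2 : 0 <= 1 - s ^+ 2 <= 1 by apply/andP; split; nra.
rewrite -(band_ge s2) subKr.
rewrite (_ : S `&` [set y | s ^+ 2 <= Z y] =
  (S `&` [set y | r * s <= tnth y i]) `|` (S `&` [set y | r * s <= - tnth y i])).
  rewrite fineU//.
    have := reflect (measurable_itv `[r * s, +oo[); rewrite set_itvcy /= => ->.
    by field.
  by apply/seteqP; split => y //= -[[_ h1] [_ h2]]; lra.
rewrite -setIUr; congr (_ `&` _); apply/seteqP.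
by split => y /=; rewrite ge_sqrZ ?(ltW s0)// => /orP.
Qed.

(** The complement of this cap is an open cap with [- s >= 0], half of the set [s^2 < Z]. Strict
    inequalities keep the two halves disjoint also at [s = 0]. *)
Lemma cap_le0 s : -1 <= s <= 0 ->
  fine (mu (S `&` [set y | r * s <= tnth y i])) =
  1 - 2^-1 * reg_incomplete_beta (1 - s ^+ 2) a 2^-1.
Proof.
move=> /andP[s0 s1]; have rs : r * s <= 0 by rewrite mulr_ge0_le0// ltW.
have s2 : 0 <= 1 - s ^+ 2 <= 1 by apply/andP; split; nra.
have ms : measurable (S `&` [set y | Z y <= s ^+ 2]).
  apply: measurableI => //; rewrite -[X in measurable X]setTI.
  by have := measurable_Z measurableT (measurable_itv `]-oo, s ^+ 2]);
    rewrite set_itvNyc.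
have ltU : S `&` [set y | s ^+ 2 < Z y] =
    (S `&` [set y | r * - s < tnth y i]) `|` (S `&` [set y | r * - s < - tnth y i]).
  rewrite -setIUr; congr (_ `&` _); apply/seteqP.
  by split => y /=; rewrite -[s ^+ 2]sqrrN gt_sqrZ ?oppr_ge0// => /orP.
have half : fine (mu (S `&` [set y | s ^+ 2 < Z y])) =
    2 * fine (mu (S `&` [set y | r * - s < - tnth y i])).
  rewrite ltU fineU//.
    have := reflect (measurable_itv `]r * - s, +oo[); rewrite set_itvoy /= => ->.
    by field.
  by apply/seteqP; split => y //= -[[_ h1] [_ h2]]; lra.
have one1 : 1 = fine (mu (S `&` [set y | Z y <= s ^+ 2])) +
    fine (mu (S `&` [set y | s ^+ 2 < Z y])).
  rewrite -fineU//; last 2 first.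
  - by rewrite ltU; exact: measurableU.
  - by apply/seteqP; split => y //= [[_ h1] [_]]; rewrite ltNge h1.
  rewrite -setIUr (_ : _ `|` _ = setT) ?setIT ?muS//.
  by apply/seteqP; split => y //= _; apply/orP; rewrite leNgt orNb.
have one2 : 1 = fine (mu (S `&` [set y | r * s <= tnth y i])) +
    fine (mu (S `&` [set y | r * - s < - tnth y i])).
  rewrite -fineU//; last first.
    by apply/seteqP; split => y //= -[[_ h1] [_ h2]]; lra.
  rewrite -setIUr (_ : _ `|` _ = setT) ?setIT ?muS//.
  apply/seteqP; split => y //= _; apply/orP.
  by rewrite mulrN ltrN2 leNgt orNb.
have := band_le s2; rewrite subKr; move: half one1 one2; lra.
Qed.

(** On the sphere [y.y = r^2], so the quadratic condition becomes linear in [y_i]; the complement of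
    the sphere is null. *)
Lemma ball_cap d :
  mu [set y | dotp y y - 2 * (r * tnth y i) + r ^+ 2 <= d ^+ 2] =
  mu (S `&` [set y | r * (1 - d ^+ 2 / (2 * r ^+ 2)) <= tnth y i]).
Proof.
set A := [set y | _].
have mA : measurable A.
  rewrite -[X in measurable X]setTI.
  have mf : measurable_fun [set: N.-tuple R]
      (fun y => dotp y y - 2 * (r * tnth y i) + r ^+ 2).
    apply: measurable_funD => //; apply: measurable_funB.
      by apply: measurable_sum => j; apply: measurable_funM; exact: measurable_tnth.
    by do 2 apply: measurable_funM => //; exact: measurable_tnth.
  by have := mf measurableT _ (measurable_itv `]-oo, d ^+ 2]); rewrite set_itvNyc.
have -> : mu A = mu (S `&` A).
  apply/eqP; rewrite eq_le [X in _ && X]le_measure ?inE ?andbT//; last exact: measurableI.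
  rewrite [X in (mu X <= _)%E](_ : A = (S `&` A) `|` (~` S `&` A)); last first.
    by rewrite -setIUl setUv setTI.
  apply: (le_trans (measureU2 _ _ _)); first exact: measurableI.
    by apply: measurableI => //; exact: measurableC.
  rewrite [X in (_ + X <= _)%E](_ : _ = 0%E) ?adde0//.
  apply/eqP; rewrite eq_le measure_ge0 andbT.
  have <- : mu (~` S) = 0%E by rewrite probability_setC// muS subee.
  by apply: le_measure; rewrite ?inE//; [apply: measurableI|]=> //; exact: measurableC.
have rE : r * (1 - d ^+ 2 / (2 * r ^+ 2)) = (2 * r ^+ 2 - d ^+ 2) / (2 * r).
  by field; rewrite gt_eqF.
congr (mu _); apply/seteqP; split => y /= [Sy]; rewrite /A/= rE;
  rewrite ler_pdivrMr ?mulr_gt0//; have /hypersphereE -> := Sy => h; split => //; lra.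
Qed.

End cap_measure.

(** * Reduction of the pair of random points to one point and a fixed pole *)

Section joint_law.
Context {R : realType} {N : nat} {disp : measure_display}.
Context {T : measurableType disp} (P : probability T R).

(** Independence is the equality on measurable rectangles; uniqueness of the product measure extends
    it to all measurable sets. *)
Lemma independent_joint_law d1 d2 (T1 : measurableType d1) (T2 : measurableType d2)
    (X : {RV P >-> T1}) (Y : {RV P >-> T2}) (A : set (T1 * T2)) :
  independent_RV X Y -> measurable A ->
  P [set u | A (X u, Y u)] = (distribution P X \x distribution P Y)%E A.
Proof.
move=> ind mA; pose XY u := (X u, Y u).
have mXY : measurable_fun setT XY by exact: measurable_fun_pair.
pose XYm := isMeasurableFun.Build _ _ _ _ XY mXY.
pose XYf : {mfun T >-> (T1 * T2)%type} := HB.pack XY XYm.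
by rewrite (@product_measure_unique _ _ _ _ _ _ _ (distribution P XYf)).
Qed.

Variables (r : R) (i : 'I_N) (p1 p2 : {RV P >-> N.-tuple R}).
Hypotheses (hp1 : uniform_on_sphere r p1) (hp2 : uniform_on_sphere r p2).

(** The product measure integrates the law of [p2] on sections. For [x] on the sphere, a reflection
    taking [x] to the pole [r e_i] shows that the section has the measure [c], independent of
    [x]. *)
Lemma close_pair_law (d : R) : 0 < r -> independent_RV p1 p2 ->
  P [set u | \sum_(k < N) (tnth (p1 u) k - tnth (p2 u) k) ^+ 2 <= d ^+ 2] =
  distribution P p2 [set y | dotp y y - 2 * (r * tnth y i) + r ^+ 2 <= d ^+ 2].
Proof.
move=> r0 ind; set c := RHS.
pose A := [set z : N.-tuple R * N.-tuple R |
  \sum_(k < N) (tnth z.1 k - tnth z.2 k) ^+ 2 <= d ^+ 2].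
have mA : measurable A.
  rewrite -[X in measurable X]setTI.
  have mf : measurable_fun [set: N.-tuple R * N.-tuple R]
      (fun z => \sum_(k < N) (tnth z.1 k - tnth z.2 k) ^+ 2).
    apply: measurable_sum => k; apply: measurable_funX; apply: measurable_funB.
      by apply: (measurableT_comp (measurable_tnth k)).
    by apply: (measurableT_comp (measurable_tnth k)).
  by have := mf measurableT _ (measurable_itv `]-oo, d ^+ 2]); rewrite set_itvNyc.
rewrite (independent_joint_law ind mA) /product_measure1/=.
have mS := @measurable_hypersphere R N r.
(* The pole [r e_i], written as [e_i - (1 - r) e_i] to fit [dotp_subZl]. *)
pose e : N.-tuple R :=
  [tuple tnth (coord_vec i) k - (1 - r) * tnth (coord_vec i) k | k < N].
have eE y : dotp e y = r * tnth y i.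
  rewrite (@dotp_subZl _ _ (coord_vec i) y (coord_vec i) e (1 - r)).
    by rewrite !dotp_coord_vec; ring.
  by move=> k; rewrite tnth_mktuple.
have ee : dotp e e = r ^+ 2.
  by rewrite eE !tnth_mktuple eqxx /=; ring.
have xsecE x : xsection A x =
    [set y | dotp x x - 2 * dotp x y + dotp y y <= d ^+ 2].
  by apply/seteqP; split => y; rewrite /xsection/= inE /A/= sqdistE.
have mB : measurable [set y : N.-tuple R |
    dotp y y - 2 * (r * tnth y i) + r ^+ 2 <= d ^+ 2].
  rewrite (_ : [set y | _] = xsection A e); first exact: measurable_xsection.
  rewrite xsecE; apply/seteqP; split => y /=; rewrite ee eE; lra.
have lawE x : hypersphere r x -> distribution P p2 (xsection A x) = c.
  move=> /hypersphereE xr; pose v : N.-tuple R := [tuple tnth x k - tnth e k | k < N].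
  have vx : householder v x = e by apply: householder_swap; rewrite xr ee.
  rewrite /c -(uniform_householder hp2 v mB) xsecE; congr (distribution P p2 _).
  apply/seteqP; split => y /=;
    by rewrite -eE -vx !dotp_householder xr; lra.
(* The section has measure [c] for [x] on the sphere, hence for almost every [x] under the law of
   [p1]. *)
rewrite (@ae_eq_integral _ _ _ _ setT (cst c))//.
- rewrite integral_cst//= [X in (_ * X)%E](_ : _ = 1%E) ?mule1//.
  exact: probability_setT.
- exact: measurable_fun_xsection.
- exists (~` hypersphere r); split; first exact: measurableC.
    have : distribution P p1 (~` hypersphere r) = 0%E; last by [].
    by rewrite probability_setC// [X in (1 - X)%E](uniform_sphere1 hp1) subee.
  by move=> x /= h Sx; apply: h => _; exact: lawE.
Qed.

End joint_law.

(** * The distribution function of the chord length *)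

Theorem mainTheorem1 (R : realType) (N : nat) (r : R)
    (disp : measure_display) (T : measurableType disp) (P : probability T R)
    (p1 p2 : {RV P >-> N.-tuple R}) (D : {RV P >-> R}) (d : R)
    (hN : (2 <= N)%N) (hr : 0 < r)
    (hp1 : uniform_on_sphere r p1) (hp2 : uniform_on_sphere r p2)
    (hind : independent_RV p1 p2)
    (hD : forall w, D w = euclid_dist (p1 w) (p2 w))
    (hd0 : 0 <= d) (hd2 : d <= 2 * r) :
  let x := d ^+ 2 / r ^+ 2 - d ^+ 4 / (4 * r ^+ 4) in
  let I := reg_incomplete_beta x ((N%:R - 1) / 2) (1 / 2) in
  (d < Num.sqrt 2 * r -> cdf D d = (1 / 2 * I)%:E) /\
  (Num.sqrt 2 * r <= d -> cdf D d = (1 - 1 / 2 * I)%:E).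
Proof.
move=> x I; pose i : 'I_N := Ordinal (ltnW hN).
(* [s] is the cosine of the central angle subtended by a chord of length [d]; accordingly
   [x = 1 - s^2] is the squared sine. *)
pose s := 1 - d ^+ 2 / (2 * r ^+ 2).
pose mu := distribution P p2.
have cdfE : cdf D d =
    (fine (mu (hypersphere r `&` [set y | r * s <= tnth y i])))%:E.
  rewrite fineK ?fin_num_measure//; last first.
    apply: measurableI; first exact: measurable_hypersphere.
    rewrite -[X in measurable X]setTI.
    by have := measurable_tnth i measurableT (measurable_itv `[r * s, +oo[);
      rewrite set_itvcy.
  have capE : mu [set y | dotp y y - 2 * (r * tnth y i) + r ^+ 2 <= d ^+ 2] =
      mu (hypersphere r `&` [set y | r * s <= tnth y i]).
    exact: (ball_cap i hr (uniform_sphere1 hp2) d).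
  rewrite -capE /mu -(close_pair_law i hp1 hp2 d hr hind).
  rewrite /cdf /distribution /pushforward; congr (P _).
  have sqrt_le (u : R) : (Num.sqrt u <= d) = (u <= d ^+ 2).
    by rewrite -{1}(ger0_norm hd0) -sqrtr_sqr ler_sqrt ?sqr_ge0.
  by apply/seteqP; split => u /=; rewrite in_itv/= hD /euclid_dist sqrt_le.
have r2 : 0 < 2 * r ^+ 2 by rewrite mulr_gt0// exprn_gt0.
have s1 : s <= 1 by rewrite /s gerBl divr_ge0 ?sqr_ge0 ?ltW.
have s_ge : -1 <= s.
  by rewrite /s lerBrDr -lerBrDl opprK ler_pdivrMr//; nra.
have xE : x = 1 - s ^+ 2 by rewrite /x /s; field; rewrite gt_eqF.
(* The threshold in [d] is the sign change of [s]; the case [d = sqrt 2 * r], that is [s = 0], falls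
   to [cap_le0]. *)
have sgt0 : (0 < s) = (d < Num.sqrt 2 * r).
  rewrite /s subr_gt0 ltr_pdivrMr// mul1r.
  rewrite -[RHS]ltr_sqr ?nnegrE ?mulr_ge0 ?sqrtr_ge0 ?(ltW hr)//.
  by rewrite exprMn sqr_sqrtr.
have inv := uniform_householder hp2; have sph := uniform_sphere1 hp2.
rewrite /I xE div1r; split => hd; rewrite cdfE; congr EFin.
  by apply: (cap_gt0 _ hN hr inv sph); rewrite sgt0 hd.
by apply: (cap_le0 _ hN hr inv sph); rewrite s_ge/= leNgt sgt0 -leNgt.
Qed.
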